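(* Let $A=\mathbb{R}[X,Y]/(X^2+Y^2-1)$, and let $x,y\in A$ be the classes of $X$ and $Y$. Consider the $A$-linear map $Q:A^2\to A^2$ with matrix $$Q=\frac12\begin{pmatrix}1+x & y\\ y & 1-x\end{pmatrix}$$ (which satisfies $Q^2=Q$), and let $M=\operatorname{Im}(Q)\subset A^2$. Then the $A$-module $M$ is not isomorphic to $A$. *)

(* Defs.v *)
From HB Require Import structures.
From mathcomp Require Import all_boot all_order all_algebra.
From mathcomp Require Import boolp reals ring.
From mathcomp Require Import mpoly.

Set Implicit Arguments.
Unset Strict Implicit.
Unset Printing Implicit Defensive.

Import GRing.Theory Num.Theory.
Local Open Scope ring_scope.
Local Open Scope quotient_scope.

Definition lmod_isomorphic (A : nzRingType) (U V : lmodType A) : Prop :=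
  exists f : {linear U -> V}, bijective f.

Section LinearImage.
Variables (A : nzRingType) (V W : lmodType A) (f : {linear V -> W}).

Definition lin_image_pred : {pred W} := fun w => `[< exists v, w = f v >].

Lemma lin_image_submod_closed : submod_closed lin_image_pred.
Proof.
split; first by apply/asboolP; exists 0; rewrite linear0.
move=> a u v /asboolP[u' ->] /asboolP[v' ->]; apply/asboolP.
by exists (a *: u' + v'); rewrite linearP.
Qed.

HB.instance Definition _ :=
  GRing.isSubmodClosed.Build A W lin_image_pred lin_image_submod_closed.

Definition lin_image : Type := {w : W | lin_image_pred w}.
HB.instance Definition _ := SubChoice.on lin_image.
HB.instance Definition _ := [SubChoice_isSubZmodule of lin_image by <:].
HB.instance Definition _ := [SubZmodule_isSubLmodule of lin_image by <:].

End LinearImage.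

Section CircleRing.
Variable R : realType.

Definition polyX : {mpoly R[2]} := 'X_ord0.
Definition polyY : {mpoly R[2]} := 'X_ord_max.

Definition circle_poly : {mpoly R[2]} := polyX ^+ 2 + polyY ^+ 2 - 1.

Definition circle_ideal : {pred {mpoly R[2]}} :=
  fun p => `[< exists q, p = q * circle_poly >].

Lemma circle_ideal_closed : idealr_closed circle_ideal.
Proof.
split.
- by apply/asboolP; exists 0; rewrite mul0r.
- apply/negP => /asboolP[q].
  move=> /(congr1 (meval (fun i : 'I_2 => (i == ord0)%:R))).
  rewrite /circle_poly /polyX /polyY !expr2 !(mevalM, mevalB, mevalD) !mevalXU.
  by rewrite !meval1 mulr1 mulr0 addr0 subrr mulr0 => /eqP; rewrite oner_eq0.
- move=> a u v /asboolP[q ->] /asboolP[r ->]; apply/asboolP.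
  by exists (a * q + r); rewrite mulrDl mulrA.
Qed.

HB.instance Definition _ :=
  isIdealr.Build {mpoly R[2]} circle_ideal circle_ideal_closed.

Definition circle_ring : Type := {ideal_quot circle_ideal}.
HB.instance Definition _ := GRing.ComNzRing.on circle_ring.
HB.instance Definition _ := Quotient.on circle_ring.

Definition circle_class (p : {mpoly R[2]}) : circle_ring :=
  \pi_({ideal_quot circle_ideal}) p.

Definition circle_x : circle_ring := circle_class polyX.
Definition circle_y : circle_ring := circle_class polyY.
(* [{ideal_quot _}] carries no R-algebra structure, so the scalar 1/2 enters as
   the class of a constant polynomial. *)
Definition circle_half : circle_ring := circle_class (2^-1)%:MP.

Definition circle_Q : 'M[circle_ring]_2 :=
  circle_half *: \matrix_(i, j)
    nth 0 (nth [::] [:: [:: 1 + circle_x; circle_y     ];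
                        [:: circle_y;     1 - circle_x ]] i) j.

Lemma circle_class_zmod_morphism : zmod_morphism circle_class.
Proof. exact: raddfB. Qed.

Lemma circle_class_monoid_morphism : monoid_morphism circle_class.
Proof. split; [exact: rmorph1 | exact: rmorphM]. Qed.

HB.instance Definition _ := GRing.isZmodMorphism.Build
  {mpoly R[2]} circle_ring circle_class circle_class_zmod_morphism.
HB.instance Definition _ := GRing.isMonoidMorphism.Build
  {mpoly R[2]} circle_ring circle_class circle_class_monoid_morphism.

Lemma circle_classE p q :
  circle_class p = circle_class q <-> exists r, p - q = r * circle_poly.
Proof.
split=> [/eqP|pq].
  by rewrite /circle_class -Quotient.idealrBE => /asboolP.
by apply/eqP; rewrite /circle_class -Quotient.idealrBE; apply/asboolP.
Qed.

Lemma circle_class1 : circle_class 1 = 1.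
Proof. exact: rmorph1. Qed.

Lemma circle_xy : circle_x ^+ 2 + circle_y ^+ 2 = 1.
Proof.
rewrite -!rmorphXn -rmorphD -[RHS]circle_class1.
by apply/circle_classE; exists 1; rewrite mul1r.
Qed.

Lemma circle_half2 : circle_half + circle_half = 1.
Proof.
have e : 2^-1 + 2^-1 = 1 :> R by field.
by rewrite -rmorphD -mpolyCD e mpolyC1; exact: circle_class1.
Qed.

Lemma circle_Q_idem : circle_Q *m circle_Q = circle_Q.
Proof.
have hy : circle_y * circle_y = 1 - circle_x * circle_x.
  by rewrite -!expr2 -circle_xy addrC addKr.
have hh a : circle_half * (a + a) = a.
  by rewrite mulrDr -mulrDl circle_half2 mul1r.
rewrite /circle_Q -scalemxAl -scalemxAr; congr (_ *: _).
apply/matrixP => i j; rewrite !mxE !big_ord_recl big_ord0 addr0 !mxE /=.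
case: i => -[|[|//]] ? /=; case: j => -[|[|//]] ? /=; rewrite -[RHS]hh ?hy;
  by congr (_ * _); ring.
Qed.

Definition circle_M : lmodType circle_ring :=
  lin_image (mulmx circle_Q : {linear 'cV_2 -> 'cV_2}).

End CircleRing.

(* Main.v *)
Require Import Defs.
From mathcomp Require Import all_boot all_order all_algebra.
From mathcomp Require Import reals.
From mathcomp Require Import boolp mpoly ring.
From mathcomp Require polyrcf.

Set Implicit Arguments.
Unset Strict Implicit.
Unset Printing Implicit Defensive.

Import Order.TTheory GRing.Theory Num.Theory.
Local Open Scope ring_scope.

(* The points of the unit circle are the (u^2 - v^2, 2uv) with u^2 + v^2 = 1,
   and Q at this point is the projection onto the line spanned by (u, v). A
   generator (a, b) of M vanishes nowhere since Q has trace 1, hence neither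
   does G(u, v) = u a + v b. But G(-u, -v) = - G(u, v), and the intermediate
   value theorem yields a zero of G on the half circle
   u = (1 - t^2) / (1 + t^2), v = 2 t / (1 + t^2), with t in [-1, 1]. *)

(** The generator is the preimage of 1 under the isomorphism; lying in the image of the idempotent
    [Q], it is fixed by [Q]. *)
Lemma idempotent_image_generator (A : comNzRingType) n (Q : 'M[A]_n) :
  Q *m Q = Q ->
  lmod_isomorphic (lin_image (mulmx Q : {linear 'cV_n -> 'cV_n})) A^o ->
  exists2 m : 'cV_n, Q *m m = m & forall w : 'cV_n, exists c, Q *m w = c *: m.
Proof.
move=> QQ [f [g fK gK]]; exists (val (g 1)).
  by case: (g 1) => w /= /asboolP[v ->]; rewrite mulmxA QQ.
move=> w; pose QL : {linear 'cV_n -> 'cV_n} := mulmx Q.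
have [z <-] : exists z : lin_image QL, val z = Q *m w.
  have wP : lin_image_pred QL (Q *m w) by apply/asboolP; exists w.
  by exists (@exist _ (fun v => is_true (lin_image_pred QL v)) _ wP).
exists (f z); rewrite -linearZ; apply: (congr1 val).
by apply: (can_inj fK); rewrite linearZ /= gK; exact/esym/mulr1.
Qed.

(** With [m] = (a, b), the columns of [Q] are c m and d m, so c a + d b is the trace of [Q], which
    is h + h = 1. The other two equations are [Q *m m = m], doubled to clear [h]. *)
Lemma circle_projector_generator (A : comNzRingType) (h x y : A) (Q : 'M[A]_2)
    (m : 'cV_2) :
  h + h = 1 ->
  Q = h *: \matrix_(i, j) nth 0 (nth [::] [:: [:: 1 + x; y]; [:: y; 1 - x]] i) j ->
  Q *m m = m -> (forall w : 'cV_2, exists c, Q *m w = c *: m) ->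
  exists a b c d : A, [/\ c * a + d * b = 1,
    a + a = (1 + x) * a + y * b & b + b = y * a + (1 - x) * b].
Proof.
move=> h2 QE Qm QP.
have [c /matrixP/(_ ord0 ord0) cE] := QP (delta_mx ord0 ord0).
have [d /matrixP/(_ ord_max ord0) dE] := QP (delta_mx ord_max ord0).
have hh z : h * z + h * z = z by rewrite -mulrDl h2 mul1r.
have mE i : m i ord0 = Q i ord0 * m ord0 ord0 + Q i ord_max * m ord_max ord0.
  rewrite -{1}Qm mxE !big_ord_recl big_ord0 addr0.
  by congr (_ + Q i _ * m _ _); apply: val_inj.
exists (m ord0 ord0), (m ord_max ord0), c, d; split.
- move: cE dE; rewrite -!colE QE !mxE /= => <- <-.
  by rewrite -mulrDr addrACA subrr addr0 mulrDr mulr1 h2.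
- by rewrite {1 2}mE QE !mxE /= -!mulrA -mulrDr hh.
- by rewrite {1 2}mE QE !mxE /= -!mulrA -mulrDr hh.
Qed.

Lemma meval_homogenize (F : fieldType) n (p : {mpoly F[n]})
    (u : 'I_n -> {poly F}) (d : {poly F}) N : (msize p <= N)%N ->
  exists P : {poly F}, forall t, d.[t] != 0 ->
    P.[t] = d.[t] ^+ N * p.@[fun i => (u i).[t] / d.[t]].
Proof.
move=> lepN.
(* A monomial of degree k has denominator d ^ k, and k is below [N], so d ^ (N - k) remains after
   clearing it. *)
exists (\sum_(m <- msupp p) p@_m *: ((\prod_i u i ^+ m i) * d ^+ (N - mdeg m))).
move=> t dt0; rewrite horner_sum mevalE mulr_sumr big_seq [RHS]big_seq.
apply: eq_bigr => m /msize_mdeg_lt mp.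
have mN : (mdeg m <= N)%N by apply: leq_trans lepN; exact: ltnW.
rewrite hornerZ hornerM !horner_exp horner_prod [RHS]mulrCA; congr (_ * _).
rewrite -{2}(subnK mN) exprD mulrC -mulrA; congr (_ * _).
rewrite mdegE -prodrXr -big_split /=; apply: eq_bigr => i _.
by rewrite horner_exp -exprMn mulrCA divff // mulr1.
Qed.

Definition pt2 (R : nzRingType) (x y : R) : 'I_2 -> R :=
  fun i => if i == ord0 then x else y.

(** Evaluation at a point of the circle kills the multiples of [circle_poly], so it depends only on
    the class. *)
Lemma meval_circle_class (R : realType) (p q : {mpoly R[2]}) (x y : R) :
  x ^+ 2 + y ^+ 2 = 1 -> circle_class p = circle_class q ->
  p.@[pt2 x y] = q.@[pt2 x y].
Proof.
move=> xy1 /circle_classE[r /(congr1 (meval (pt2 x y)))].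
rewrite mevalM !mevalB mevalD !rmorphXn /= !mevalXU meval1 /pt2 /= xy1 subrr mulr0.
by move/eqP; rewrite subr_eq0 => /eqP.
Qed.

Lemma circle_class_surj (R : realType) (z : circle_ring R) :
  exists p, z = circle_class p.
Proof.
by exists (generic_quotient.repr z); rewrite /circle_class generic_quotient.reprK.
Qed.

(** The hypothesis says that (a, b) is parallel to (u, v) at the point of the circle whose angle is
    twice that of (u, v). *)
Lemma tautological_section_zero (R : rcfType) (a b : {mpoly R[2]}) :
  (forall u v, u ^+ 2 + v ^+ 2 = 1 ->
    v * a.@[pt2 (u ^+ 2 - v ^+ 2) (2 * u * v)] =
    u * b.@[pt2 (u ^+ 2 - v ^+ 2) (2 * u * v)]) ->
  exists x y, [/\ x ^+ 2 + y ^+ 2 = 1, a.@[pt2 x y] = 0 & b.@[pt2 x y] = 0].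
Proof.
move=> ab; pose N := maxn (msize a) (msize b).
(* [X] / [d] and [Y] / [d] are u^2 - v^2 and 2uv for the rational parametrization (u, v) of the half
   circle. *)
pose d : {poly R} := (1%:P + 'X ^+ 2) ^+ 2.
pose X : {poly R} := (1%:P - 'X ^+ 2) ^+ 2 - (2%:P * 'X) ^+ 2.
pose Y : {poly R} := 2%:P * (1%:P - 'X ^+ 2) * (2%:P * 'X).
pose hE := (hornerM, hornerD, hornerN, horner_exp, hornerX, hornerC).
have [Pa PaE] := meval_homogenize (pt2 X Y) d (leq_maxl (msize a) (msize b)).
have [Pb PbE] := meval_homogenize (pt2 X Y) d (leq_maxr (msize a) (msize b)).
have t2 t : 1 + t ^+ 2 != 0 :> R.
  by rewrite gt_eqF // ltr_pwDl ?ltr01 // sqr_ge0.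
have dE t : d.[t] = (1 + t ^+ 2) ^+ 2 by rewrite /d !hE.
have d0 t : d.[t] != 0 by rewrite dE expf_neq0.
pose u t : R := (1 - t ^+ 2) / (1 + t ^+ 2).
pose v t : R := 2 * t / (1 + t ^+ 2).
have uv t : u t ^+ 2 + v t ^+ 2 = 1 by rewrite /u /v; field.
pose x t := u t ^+ 2 - v t ^+ 2; pose y t := 2 * u t * v t.
have XY t : (fun i => (pt2 X Y i).[t] / d.[t]) =1 pt2 (x t) (y t).
  by move=> i; rewrite /pt2 dE /x /y /u /v /X /Y; case: ifP => _;
    rewrite !hE; field.
have {}PaE t : Pa.[t] = d.[t] ^+ N * a.@[pt2 (x t) (y t)].
  by rewrite PaE // (meval_eq _ (XY t)).
have {}PbE t : Pb.[t] = d.[t] ^+ N * b.@[pt2 (x t) (y t)].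
  by rewrite PbE // (meval_eq _ (XY t)).
(* The ends t = -1 and t = 1 give (u, v) = (0, -1) and (0, 1), both lying over the point (-1, 0). *)
have Pb1 : Pb.[-1] = Pb.[1].
  have u1 : u 1 = 0 by rewrite /u expr1n subrr mul0r.
  have uN t : u (- t) = u t by rewrite /u sqrrN.
  have vN t : v (- t) = - v t by rewrite /v sqrrN mulrN mulNr.
  by rewrite !PbE !dE /x /y uN vN !sqrrN u1 mulr0 !mul0r.
(* This polynomial is (1 + t^2) d^N G. Its values at -1 and 1 are opposite, namely -2 Pb(1) and 2
   Pb(1). *)
have [||t _] :=
    @polyrcf.poly_ivt R ((1%:P - 'X ^+ 2) * Pa + 2%:P * 'X * Pb) (-1) 1.
- exact: le_trans (lerN10 _) ler01.
- rewrite !hE Pb1 mulrNN mulr1 subrr !mul0r !add0r.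
  rewrite mulrN mulNr mulNr mulr1 oppr_le0.
  exact: sqr_ge0.
rewrite /root !hE PaE PbE => /eqP G0.
set A := a.@[_] in G0; set B := b.@[_] in G0.
have {}G0 : u t * A + v t * B = 0.
  move: (d.[t] ^+ N) (expf_neq0 N (d0 t)) G0 => D D0 G0.
  apply: (mulfI (mulf_neq0 (t2 t) D0)); rewrite mulr0 -[RHS]G0 /u /v.
  by move: A B {G0} => A B; field.
have AB : v t * A = u t * B := ab _ _ (uv t).
(* u A + v B and v A - u B are the coordinates of (A, B) in the orthonormal basis (u, v), (v, -u);
   both vanish, so A = B = 0. *)
exists (x t), (y t); split.
- by rewrite /x /y -[RHS](expr1n _ 2) -[in RHS](uv t); ring.
- rewrite -/A -[A]mul1r -(uv t).
  have -> : (u t ^+ 2 + v t ^+ 2) * A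
    = u t * (u t * A + v t * B) + v t * (v t * A - u t * B) by ring.
  by rewrite G0 AB subrr !mulr0 addr0.
- rewrite -/B -[B]mul1r -(uv t).
  have -> : (u t ^+ 2 + v t ^+ 2) * B
    = v t * (u t * A + v t * B) - u t * (v t * A - u t * B) by ring.
  by rewrite G0 AB subrr !mulr0 subr0.
Qed.

Theorem mainTheorem1 (R : realType) :
  ~ lmod_isomorphic (circle_M R) (circle_ring R)^o.
Proof.
move=> /(idempotent_image_generator (circle_Q_idem R))[m Qm QP].
have [a' [b' [c' [d' []]]]] :=
  circle_projector_generator (circle_half2 R) erefl Qm QP.
have [[a ->] [b ->]] := (circle_class_surj a', circle_class_surj b').
have [[c ->] [d ->]] := (circle_class_surj c', circle_class_surj d').
rewrite /circle_x /circle_y -(circle_class1 R).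
rewrite -!rmorphM -!rmorphB -!rmorphD -!rmorphM -!rmorphD.
move=> e1 e2 e3.
have {}e1 x y (xy : x ^+ 2 + y ^+ 2 = 1) := meval_circle_class xy e1.
have {}e2 x y (xy : x ^+ 2 + y ^+ 2 = 1) := meval_circle_class xy e2.
have {}e3 x y (xy : x ^+ 2 + y ^+ 2 = 1) := meval_circle_class xy e3.
have [|x [y [xy a0 b0]]] := @tautological_section_zero R a b.
  move=> u v uv; set x := u ^+ 2 - v ^+ 2; set y := 2 * u * v.
  have xy : x ^+ 2 + y ^+ 2 = 1.
    by rewrite /x /y -[RHS](expr1n _ 2) -[in RHS]uv; ring.
  move: (e2 x y xy) (e3 x y xy).
  rewrite !(mevalD, mevalN, mevalM, meval1, mevalXU) /pt2 /=.
  set A := a.@[_]; set B := b.@[_] => eA eB.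
  have v2 : (2 : R) != 0 by rewrite pnatr_eq0.
  apply: (mulfI v2); apply/eqP; rewrite -subr_eq0; apply/eqP.
  (* Here 1 + x = 2u^2, 1 - x = 2v^2 and y = 2uv, so after substitution by [eA] and [eB] the terms
     cancel. *)
  transitivity (v * (A + A) - u * (B + B)); first by ring.
  by rewrite eA eB -uv /x /y; ring.
(* At the common zero of [a] and [b], the relation c a + d b = 1 reads 0 = 1. *)
have := e1 x y xy; rewrite mevalD !mevalM a0 b0 meval1 !mulr0 addr0 => /esym/eqP.
by rewrite oner_eq0.
Qed.
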